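(* Let $S\subseteq(A\times B)\times O$ and $T\subseteq(P\times Q)\times Z$ be communication problems, and let $\Lambda$ be a $\delta$-fooling set of $T$. Then $\mathsf{Cov}(S\times T)\geq\mathsf{Cov}(S)/\delta$. In particular, $$\log\mathsf{Cov}(S\times T)\geq\log\mathsf{Cov}(S)+\log\mathsf{Cov}(T)-\log\log|P||Q|-4.$$
   Context: A communication problem is a relation $S\subseteq (X\times Y)\times Z$ with $X,Y,Z$ finite, where Alice gets $x\in X$, Bob gets $y\in Y$ and they must output $z$ with $(x,y,z)\in S$; every $(x,y)$ has at least one valid $z$. A rectangle is $X'\times Y'$ with $X'\subseteq X,Y'\subseteq Y$; it is monochromatic with color $z$ if $(x,y,z)\in S$ for all its elements. For $\Sigma\subseteq X\times Y$, $\mathsf{Cov}(\Sigma)$ is the minimum number of monochromatic rectangles covering $\Sigma$, and $\mathsf{Cov}(S)=\mathsf{Cov}(X\times Y)$. The direct sum $S\times T\subseteq((A\times P)\times(B\times Q))\times(O\times Z)$ is the problem where Alice gets $(a,p)$, Bob gets $(b,q)$, and a valid output is $(o,z)$ with $(a,b,o)\in S$ and $(p,q,z)\in T$. A set $\Lambda\subseteq P\times Q$ is a $\delta$-fooling set of $T$ if for every $\tilde\Lambda\subseteq\Lambda$ with $|\tilde\Lambda|/|\Lambda|>\delta$ no monochromatic rectangle of $T$ contains all of $\tilde\Lambda$. Logarithms are base 2. *)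

(* Defs.v *)
From HB Require Import structures.
From mathcomp Require Import all_boot all_order all_algebra.
From mathcomp Require Import reals exp.

Set Implicit Arguments.
Unset Strict Implicit.
Unset Printing Implicit Defensive.

Import Order.TTheory GRing.Theory Num.Theory.
Local Open Scope ring_scope.

Record comm_problem (X Y Z : finType) := CommProblem {
  cp_rel :> {set (X * Y) * Z};
  cp_total : forall x y, exists z, (x, y, z) \in cp_rel
}.

Section Cover.
Variables (X Y Z : finType) (S : comm_problem X Y Z).

Definition rectangle (R : {set X * Y}) : bool :=
  [exists X' : {set X}, exists Y' : {set Y}, R == setX X' Y'].

Definition monochromatic (R : {set X * Y}) : bool :=
  [exists z : Z, forall xy in R, (xy, z) \in cp_rel S].

Definition mono_rect (R : {set X * Y}) : bool :=
  rectangle R && monochromatic R.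

Definition mono_cover (Sigma : {set X * Y}) (F : {set {set X * Y}}) : bool :=
  [forall R in F, mono_rect R] && (Sigma \subset cover F).

Definition coverable_by (Sigma : {set X * Y}) (n : nat) : bool :=
  [exists F : {set {set X * Y}}, mono_cover Sigma F && (#|F| == n)].

Lemma coverable (Sigma : {set X * Y}) : exists n, coverable_by Sigma n.
Proof.
pose F := [set [set xy] | xy in [set: X * Y]].
exists #|F|; apply/existsP; exists F; rewrite eqxx andbT.
apply/andP; split.
  apply/'forall_implyP=> _ /imsetP[[x y] _ ->]; apply/andP; split.
    apply/existsP; exists [set x]; apply/existsP; exists [set y].
    by apply/eqP/setP=> -[a b]; rewrite !inE xpair_eqE.
  have [z Sz] := cp_total S x y; apply/existsP; exists z.
  by apply/'forall_implyP=> xy /set1P ->.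
apply/subsetP=> xy _; apply/bigcupP; exists [set xy]; last exact: set11.
by apply: imset_f; rewrite inE.
Qed.

Definition Cov_on (Sigma : {set X * Y}) : nat := ex_minn (coverable Sigma).

Definition Cov : nat := Cov_on [set: X * Y].

(* The quotient |L| / |Lambda| only makes sense for a nonempty Lambda. *)
Definition fooling_set (R : realType) (delta : R) (Lambda : {set X * Y}) : Prop :=
  Lambda != set0 /\
  forall L : {set X * Y}, L \subset Lambda ->
    delta < #|L|%:R / #|Lambda|%:R ->
    ~ exists M : {set X * Y}, mono_rect M /\ L \subset M.

End Cover.

Section DirectSum.
Variables (A B O P Q Z : finType).
Variables (S : comm_problem A B O) (T : comm_problem P Q Z).

Definition direct_sum_rel : {set ((A * P) * (B * Q)) * (O * Z)} :=
  [set u | let: (((a, p), (b, q)), (o, z)) := u in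
           (((a, b), o) \in cp_rel S) && (((p, q), z) \in cp_rel T)].

Lemma direct_sum_total (x : A * P) (y : B * Q) :
  exists oz, (x, y, oz) \in direct_sum_rel.
Proof.
case: x y => [a p] [b q].
have [o So] := cp_total S a b; have [z Tz] := cp_total T p q.
by exists (o, z); rewrite inE So Tz.
Qed.

Definition direct_sum : comm_problem (A * P)%type (B * Q)%type (O * Z)%type :=
  CommProblem direct_sum_total.

End DirectSum.

Definition log2 (R : realType) (x : R) : R := ln x / ln 2.

(* Main.v *)
Require Import Defs.
From HB Require Import structures.
From mathcomp Require Import all_boot all_order all_algebra.
From mathcomp Require Import reals exp.
From mathcomp Require Import sequences ring lra.

(** A monochromatic rectangle of [S x T] projects to a monochromatic rectangle
    of [T], and its slice over a point [(p, q)] is a monochromatic rectangle of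
    [S].  The slices over [(p, q)] of a cover [F] of [S x T] cover [S], so the
    projections of [F] cover each point of [P x Q] at least [Cov S] times.

    Counting incidences with a fooling set, which meets each projection in at
    most a [delta] fraction, gives the first bound.

    For the second bound no fooling set is needed: the projections form a
    fractional cover of [T] of weight [r = #|F| / Cov S], and the greedy
    algorithm extracts from it a cover of at most [r * ln (#|P| * #|Q|) + 1]
    rectangles. *)

Set Implicit Arguments.
Unset Strict Implicit.
Unset Printing Implicit Defensive.

Import Order.TTheory GRing.Theory Num.Theory.
Local Open Scope ring_scope.

(** * Averaging and greedy selection in a multiple cover *)

Section MultipleCover.
Local Open Scope nat_scope.
(** The sets are indexed by [F] because distinct rectangles can have the same projection, and each
    must count towards the multiplicity. *)
Variables (I D : finType) (F : {set I}) (G : I -> {set D}).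

Lemma sum_card_setI (U : {set D}) :
  \sum_(i in F) #|U :&: G i| = \sum_(x in U) #|[set i in F | x \in G i]|.
Proof.
transitivity (\sum_(i in F) \sum_(x in U) (x \in G i : nat)).
  apply: eq_bigr => i _; rewrite -sum1_card [RHS]big_mkcond [LHS]big_mkcond /=.
  by apply: eq_bigr => x _; rewrite inE; do 2!case: (_ \in _).
rewrite exchange_big /=; apply: eq_bigr => x _.
rewrite -sum1_card [RHS]big_mkcond [LHS]big_mkcond /=.
by apply: eq_bigr => i _; rewrite inE; do 2!case: (_ \in _).
Qed.

Variable k : nat.
Hypothesis Gk : forall x, k <= #|[set i in F | x \in G i]|.

Lemma multicover_sum (U : {set D}) : #|U| * k <= \sum_(i in F) #|U :&: G i|.
Proof. by rewrite sum_card_setI -sum_nat_const leq_sum. Qed.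

(** Averaging: if every [G i] met [U] in less than a [k / #|F|] fraction, the incidence count of
    [multicover_sum] would fail. *)
Lemma multicover_max (U : {set D}) : 0 < #|F| ->
  exists2 i, i \in F & k * #|U| <= #|F| * #|U :&: G i|.
Proof.
move=> F_gt0; apply/exists_inP; apply: contraLR (multicover_sum U).
rewrite negb_exists_in => /forall_inP lt_i; rewrite -ltnNge.
rewrite -(ltn_pmul2l F_gt0) big_distrr /= mulnC [#|U| * k]mulnC.
have [i0 Fi0] := card_gt0P F_gt0.
have lti i : i \in F -> #|F| * #|U :&: G i| < k * #|U|.
  by move=> Fi; rewrite ltnNge lt_i.
(* Splitting off [i0] keeps one strict term, which makes the comparison of the sums strict. *)
rewrite mulnC -sum_nat_const (bigD1 i0) //= [X in _ < X](bigD1 i0) //=.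
by rewrite -addSn leq_add ?lti // leq_sum // => i /andP[Fi _]; rewrite ltnW ?lti.
Qed.

(** Each greedy round shrinks the uncovered part by a factor of at most [1 - k / #|F|]; denominators
    are cleared to stay in [nat]. A round may pick an index already in [J], hence only
    [#|J| <= t]. *)
Lemma greedy_cover (t : nat) : 0 < #|F| ->
  exists J : {set I}, [/\ J \subset F, #|J| <= t &
    #|~: \bigcup_(i in J) G i| * #|F| ^ t <= #|D| * (#|F| - k) ^ t].
Proof.
move=> F_gt0; elim: t => [|t [J [JF Jt IH]]].
  by exists set0; rewrite sub0set cards0 !muln1; split=> //; apply: max_card.
set U := ~: _ in IH; have [i Fi le_i] := multicover_max U F_gt0.
exists (i |: J); split.
- by rewrite subUset sub1set Fi.
- by rewrite cardsU1 (leq_trans (leq_add (leq_b1 _) Jt)).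
- have -> : ~: (\bigcup_(j in i |: J) G j) = U :\: G i.
    by rewrite bigcup_setU big_set1 setCU setIC setDE.
  have le_UG : #|U :\: G i| * #|F| <= (#|F| - k) * #|U|.
    by rewrite cardsD mulnBl mulnBl mulnC [X in _ - X]mulnC leq_sub2l.
  rewrite !expnS mulnA (leq_trans (leq_mul le_UG (leqnn _))) //.
  by rewrite -mulnA [X in _ <= X]mulnCA leq_mul2l IH orbT.
Qed.

End MultipleCover.

(** * Covering numbers and fooling sets *)

Section CovTheory.
Variables (X Y Z : finType) (S : comm_problem X Y Z).

Lemma Cov_min (F : {set {set X * Y}}) :
  mono_cover S [set: X * Y] F -> (Cov S <= #|F|)%N.
Proof.
move=> covF; rewrite /Cov /Cov_on; case: ex_minnP => n _; apply.
by apply/existsP; exists F; rewrite covF eqxx.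
Qed.

Lemma Cov_attained :
  exists2 F : {set {set X * Y}}, mono_cover S [set: X * Y] F & #|F| = Cov S.
Proof.
rewrite /Cov /Cov_on; case: ex_minnP => n /existsP[F /andP[covF /eqP <-]] _.
by exists F.
Qed.

Lemma Cov_gt0 : (0 < #|X|)%N -> (0 < #|Y|)%N -> (0 < Cov S)%N.
Proof.
move=> /card_gt0P[x _] /card_gt0P[y _].
have [F /andP[_ /subsetP/(_ (x, y))]] := Cov_attained.
rewrite inE => /(_ isT)/bigcupP[M FM _] <-.
by apply/card_gt0P; exists M.
Qed.

Lemma mono_rect_set1 (u : X * Y) : mono_rect S [set u].
Proof.
case: u => x y; apply/andP; split.
  apply/existsP; exists [set x]; apply/existsP; exists [set y].
  by apply/eqP/setP=> -[a b]; rewrite !inE xpair_eqE.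
have [z Sz] := cp_total S x y; apply/existsP; exists z.
by apply/forall_inP=> u /set1P ->.
Qed.

(** A point of [Lambda] is a positive fraction of it and, as a singleton, is itself a monochromatic
    rectangle, so [delta <= 0] is impossible. This makes division by [delta] meaningful. *)
Lemma fooling_set_gt0 (R : realType) (delta : R) (Lambda : {set X * Y}) :
  fooling_set S delta Lambda -> 0 < delta.
Proof.
case=> /set0Pn[u Lu] fool; rewrite ltNge; apply/negP => delta_le0.
have L_gt0 : (0 < #|Lambda|)%N by apply/card_gt0P; exists u.
apply: (fool [set u]); first by rewrite sub1set.
  by rewrite cards1 (le_lt_trans delta_le0) // divr_gt0 ?ltr0n.
by exists [set u]; split; first exact: mono_rect_set1.
Qed.

End CovTheory.

(** * Slices and projections of rectangles of a direct sum *)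

Section Projection.
Variables (A B O P Q Z : finType).
Variables (S : comm_problem A B O) (T : comm_problem P Q Z).
Implicit Type M : {set (A * P) * (B * Q)}.

Definition rect_slice (u : P * Q) M : {set A * B} :=
  [set ab | ((ab.1, u.1), (ab.2, u.2)) \in M].

Definition rect_proj M : {set P * Q} := [set u | rect_slice u M != set0].

Lemma mono_rect_slice u M :
  mono_rect (direct_sum S T) M -> mono_rect S (rect_slice u M).
Proof.
case/andP=> /existsP[X' /existsP[Y' /eqP defM]] /existsP[[o z] /forall_inP Moz].
apply/andP; split.
  apply/existsP; exists [set a | (a, u.1) \in X'].
  apply/existsP; exists [set b | (b, u.2) \in Y'].
  by apply/eqP/setP=> -[a b]; rewrite defM !inE.
apply/existsP; exists o; apply/forall_inP=> -[a b]; rewrite inE => /Moz.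
by rewrite inE => /andP[].
Qed.

(** In a product [X' * Y'] the witnesses [a] for [p] and [b] for [q] are chosen independently, so
    the projection is again a product. The second component of the color of [M] colors it. *)
Lemma mono_rect_proj M :
  mono_rect (direct_sum S T) M -> mono_rect T (rect_proj M).
Proof.
case/andP=> /existsP[X' /existsP[Y' /eqP defM]] /existsP[[o z] /forall_inP Moz].
apply/andP; split.
  apply/existsP; exists [set p | [exists a, (a, p) \in X']].
  apply/existsP; exists [set q | [exists b, (b, q) \in Y']].
  apply/eqP/setP=> -[p q]; rewrite !inE; apply/set0Pn/andP.
    case=> -[a b]; rewrite defM !inE /= => /andP[Xa Yb].
    by split; apply/existsP; [exists a | exists b].
  case=> /existsP[a Xa] /existsP[b Yb]; exists (a, b).
  by rewrite defM !inE /= Xa.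
apply/existsP; exists z; apply/forall_inP=> -[p q].
rewrite inE => /set0Pn[[a b]]; rewrite inE => /Moz.
by rewrite inE => /andP[].
Qed.

(** Only rectangles whose projection contains [u] have a nonempty slice over [u], and these slices
    already cover [S]; coinciding slices only lower their number. *)
Lemma Cov_le_proj_multiplicity (F : {set {set (A * P) * (B * Q)}}) u :
  mono_cover (direct_sum S T) setT F ->
  (Cov S <= #|[set M in F | u \in rect_proj M]|)%N.
Proof.
case/andP=> /forall_inP Fmono /subsetP Fcov.
apply: leq_trans (leq_imset_card (rect_slice u) _); apply: Cov_min.
apply/andP; split.
  apply/forall_inP=> _ /imsetP[M + ->]; rewrite inE => /andP[FM _].
  exact: mono_rect_slice (Fmono M FM).
apply/subsetP=> -[a b] _.
have /bigcupP[M FM Mab] := Fcov ((a, u.1), (b, u.2)) (in_setT _).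
have ab_slice : (a, b) \in rect_slice u M by rewrite inE.
apply/bigcupP; exists (rect_slice u M) => //; apply: imset_f.
by rewrite inE FM inE; apply/set0Pn; exists (a, b).
Qed.

Lemma Cov_le_direct_sum :
  (0 < #|P|)%N -> (0 < #|Q|)%N -> (Cov S <= Cov (direct_sum S T))%N.
Proof.
move=> /card_gt0P[p _] /card_gt0P[q _].
have [F Fcov <-] := Cov_attained (direct_sum S T).
apply: leq_trans (Cov_le_proj_multiplicity (p, q) Fcov) _.
by apply/subset_leq_card/subsetP=> M /setIdP[].
Qed.

Lemma Cov_direct_sum_fooling (R : realType) (delta : R) (Lambda : {set P * Q}) :
  fooling_set T delta Lambda ->
  (Cov S)%:R / delta <= (Cov (direct_sum S T))%:R.
Proof.
move=> fool; have delta_gt0 := fooling_set_gt0 fool.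
case: fool => Lambda_n0 fool.
have L_gt0 : 0 < #|Lambda|%:R :> R by rewrite ltr0n card_gt0.
have [F Fcov <-] := Cov_attained (direct_sum S T).
rewrite ler_pdivrMr // -(ler_pM2l L_gt0).
have := multicover_sum (fun u => Cov_le_proj_multiplicity u Fcov) Lambda.
rewrite -(ler_nat R) natrM natr_sum => /le_trans; apply.
have -> : #|Lambda|%:R * (#|F|%:R * delta) = \sum_(M in F) (delta * #|Lambda|%:R).
  by rewrite sumr_const -mulr_natr; ring.
(* If [M] exceeded its share, the part of [Lambda] inside the monochromatic rectangle [rect_proj M]
   would contradict the fooling property. *)
apply: ler_sum => M FM; rewrite -ler_pdivrMr // leNgt; apply/negP => ltd.
apply: (fool _ (subsetIl _ _) ltd).
exists (rect_proj M); split; last exact: subsetIr.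
by apply: mono_rect_proj; case/andP: Fcov => /forall_inP/(_ M FM).
Qed.

Lemma Cov_le_direct_sum_ln (R : realType) :
  (0 < #|A|)%N -> (0 < #|B|)%N -> (0 < #|P| * #|Q|)%N ->
  (Cov T)%:R <= (Cov (direct_sum S T))%:R / (Cov S)%:R
                  * ln (#|P| * #|Q|)%:R + 1 :> R.
Proof.
move=> A_gt0 B_gt0 N_gt0.
have k_gt0 := Cov_gt0 S A_gt0 B_gt0.
have /andP[P_gt0 Q_gt0] : (0 < #|P|)%N && (0 < #|Q|)%N by rewrite -muln_gt0.
have := Cov_le_direct_sum P_gt0 Q_gt0.
have [F Fcov <-] := Cov_attained (direct_sum S T) => le_kF.
have mult u := Cov_le_proj_multiplicity u Fcov.
have F_gt0 := leq_trans k_gt0 le_kF.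
have kR : 0 < (Cov S)%:R :> R by rewrite ltr0n.
have FR : 0 < #|F|%:R :> R by rewrite ltr0n.
have NR : 0 < (#|P| * #|Q|)%:R :> R by rewrite ltr0n.
set r := _ / _; have r_gt0 : 0 < r by rewrite divr_gt0.
have lnN_ge0 : 0 <= ln (#|P| * #|Q|)%:R :> R by rewrite ln_ge0 // ler1n.
set b := r * _; have b_ge0 : 0 <= b by rewrite mulr_ge0 // ltW.
(* The greedy algorithm runs for [t + 1] rounds with [t] the floor of [b = r * ln N]: [t <= b]
   bounds the size of the cover, and the strict [b < t + 1] forces it to be complete. *)
have /andP[le_tb lt_bt] := Num.Theory.truncn_itv b_ge0.
set t := Num.truncn b in le_tb lt_bt.
have [J [JF Jt le_unc]] := greedy_cover mult t.+1 F_gt0.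
apply: le_trans (_ : t.+1%:R <= _); last by rewrite -natr1 lerD2r.
rewrite ler_nat; apply: leq_trans Jt; apply: leq_trans (leq_imset_card rect_proj _).
apply: Cov_min; apply/andP; split.
  apply/forall_inP=> _ /imsetP[M JM ->]; apply: mono_rect_proj.
  by case/andP: Fcov => /forall_inP/(_ M (subsetP JF M JM)).
suff unc0 : ~: (\bigcup_(M in J) rect_proj M) = set0.
  by rewrite cover_imset -setCS unc0 sub0set.
(* The number of uncovered points is a natural number, so a real bound strictly below 1 makes it
   0. *)
apply/eqP; rewrite -cards_eq0 -leqn0 -ltnS -(ltr_nat R).
set m := #|_| in le_unc *.
move: le_unc; rewrite card_prod -(ler_nat R) !natrM !natrX natrB // -natrM.
set N := (#|P| * #|Q|)%:R in NR b b_ge0 t le_tb lt_bt *.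
rewrite -ler_pdivlMr ?exprn_gt0 // -mulrA -expr_div_n.
have -> : (#|F|%:R - (Cov S)%:R) / #|F|%:R = 1 - r^-1.
  by rewrite mulrBl divff ?gt_eqF // /r invf_div.
move=> le_m; apply: le_lt_trans le_m _.
have rV_le1 : 0 <= 1 - r^-1.
  by rewrite subr_ge0 invf_div ler_pdivrMr // mul1r ler_nat.
(* By [1 + x <= expR x]; raising it to a power uses [0 <= 1 - r^-1], that is [Cov S <= #|F|]. *)
apply: le_lt_trans (_ : N * expR (- r^-1) ^+ t.+1 < _).
  rewrite ler_wpM2l ?(ltW NR) // lerXn2r ?nnegrE ?expR_ge0 //.
  exact: expR_ge1Dx.
(* With [N = expR (ln N)], the claim is that the exponent [ln N - (t + 1) / r] is negative, which is
   [b < t + 1]. *)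
rewrite -expRM_natl -{1}(lnK (x := N)) ?posrE // -expRD expR_lt1.
by rewrite mulrN subr_lt0 ltr_pdivlMr // mulrC.
Qed.

End Projection.

(** * Both bounds, the second in binary logarithms *)

Theorem theorem4p1 (R : realType) (A B O P Q Z : finType)
    (S : comm_problem A B O) (T : comm_problem P Q Z) :
  (forall (delta : R) (Lambda : {set P * Q}),
     fooling_set T delta Lambda ->
     (Cov S)%:R / delta <= (Cov (direct_sum S T))%:R)
  /\
  ((0 < #|A|)%N -> (0 < #|B|)%N -> (1 < #|P| * #|Q|)%N ->
   log2 (Cov S)%:R + log2 (Cov T)%:R
     - log2 (log2 (#|P| * #|Q|)%:R) - 4
   <= log2 (Cov (direct_sum S T))%:R :> R).
Proof.
split; first by move=> delta Lambda; apply: Cov_direct_sum_fooling.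
move=> A_gt0 B_gt0 N_gt1; have N_gt0 := ltnW N_gt1.
have /andP[P_gt0 Q_gt0] : (0 < #|P|)%N && (0 < #|Q|)%N by rewrite -muln_gt0.
have S_gt0 : 0 < (Cov S)%:R :> R by rewrite ltr0n Cov_gt0.
have T_gt0 : 0 < (Cov T)%:R :> R by rewrite ltr0n Cov_gt0.
have ST_gt0 : 0 < (Cov (direct_sum S T))%:R :> R.
  by rewrite ltr0n Cov_gt0 // card_prod muln_gt0 ?A_gt0 ?B_gt0.
have ln2_gt0 : 0 < ln 2 :> R by rewrite ln_gt0 // ltr1n.
have ln2_le1 : ln 2 <= 1 :> R.
  by apply: (@le_ln1Dx R 1); rewrite (lt_trans (ltrN10 R)) ?ltr01.
have lnN : ln 2 <= ln (#|P| * #|Q|)%:R :> R.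
  by rewrite ler_ln ?posrE ?ltr0n // ler_nat.
pose l : R := log2 (#|P| * #|Q|)%:R.
have l_ge1 : 1 <= l by rewrite ler_pdivlMr // mul1r.
have l_gt0 : 0 < l by exact: lt_le_trans l_ge1.
have lnN_le : ln (#|P| * #|Q|)%:R <= l.
  by rewrite ler_pdivlMr // ler_piMr // ltW // (lt_le_trans _ lnN).
have ST_ge : 1 <= (Cov (direct_sum S T))%:R / (Cov S)%:R :> R.
  by rewrite ler_pdivlMr // mul1r ler_nat Cov_le_direct_sum.
have T_le := Cov_le_direct_sum_ln S T R A_gt0 B_gt0 N_gt0.
(* With [r] the ratio of the covering numbers of [direct_sum S T] and [S]: since [ln N <= l],
   [1 <= r] and [1 <= l], we get [r * ln N + 1 <= 2 * r * l]. *)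
have {}T_le :
    (Cov T)%:R * (Cov S)%:R <= (Cov (direct_sum S T))%:R * (l * 2) :> R.
  by rewrite -ler_pdivlMr // mulrAC; apply: le_trans T_le _; nra.
have le_ln : ln (Cov T)%:R + ln (Cov S)%:R
    <= ln (Cov (direct_sum S T))%:R + (ln l + ln 2) :> R.
  have l2_gt0 : 0 < l * 2 by rewrite mulr_gt0.
  rewrite -(lnM (x := l)) ?posrE // -!lnM ?posrE //.
  by rewrite ler_ln ?posrE // mulr_gt0.
rewrite -/l /log2 -mulrDl -mulrBl lerBlDr.
(* Over the common denominator [ln 2], the factor 2 costs a single [ln 2], well within the allowed
   [4 * ln 2]. *)
have -> : 4 = (4 * ln 2) / ln 2 :> R by rewrite mulfK // gt_eqF.
by rewrite -mulrDl ler_pM2r ?invr_gt0 //; lra.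
Qed.
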